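(* Let $(G,H,\alpha,\tau)$ be a Lie crossed module, $\pi:P\to M$ a principal $G$-bundle, and $\bar A$, $A$ connection forms on it. Let $B_0$ be an $L(G)$-valued $2$-form, $B_1$ an $L(H)$-valued $2$-form, $C_0^L,C_0^R$ $L(G)$-valued $1$-forms and $C_1^L,C_1^R$ $L(H)$-valued $1$-forms on $P$, all equivariant and horizontal (as defined in the context). On the decorated bundle $\mathcal{P}^{\rm dec}_{\bar A}P=\mathcal{P}_{\bar A}P\times H\to\mathcal{P}M$ consider the connection form $$\Omega_{(\bar\gamma,h)}(\bar v+X)=\mathrm{Ad}(h^{-1})\Big[\omega_{\bar\gamma}(\bar v)+C_1^R|_{\bar\gamma(t_1)}(\bar v(t_1))-C_1^L|_{\bar\gamma(t_0)}(\bar v(t_0))+\int_{t_0}^{t_1}B_1|_{\bar\gamma(t)}\big(\bar v(t),\bar\gamma'(t)\big)dt+Xh^{-1}\Big],$$ where $$\omega_{\bar\gamma}(\bar v)=A_{\bar\gamma(t_0)}(\bar v(t_0))+C_0^R|_{\bar\gamma(t_1)}(\bar v(t_1))-C_0^L|_{\bar\gamma(t_0)}(\bar v(t_0))+\int_{t_0}^{t_1}B_0|_{\bar\gamma(t)}\big(\bar v(t),\bar\gamma'(t)\big)dt .$$ Then a path $$[s_0,s_1]\to\mathcal{P}^{\rm dec}_{\bar A}P,\qquad s\mapsto(\tilde\Gamma_s,h_s)$$ is $\Omega$-horizontal if and only if $s\mapsto\tilde\Gamma_s$ is an $\omega$-horizontal path on $\mathcal{P}_{\bar A}P$ and $s\mapsto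 h_s$ satisfies the differential equation $$\dot h_sh_s^{-1}=-\Big[C_1^R\big(\partial_s\tilde\Gamma_s(t_1)\big)-C_1^L\big(\partial_s\tilde\Gamma_s(t_0)\big)+\int_{t_0}^{t_1}B_1\big(\partial_s\tilde\Gamma_s(t),\partial_t\tilde\Gamma_s(t)\big)\,dt\Big].$$
   Context: A Lie crossed module $(G,H,\alpha,\tau)$ consists of Lie groups $G,H$, a smooth homomorphism $\tau:H\to G$ and a homomorphism $\alpha:G\to\mathrm{Aut}(H)$ with $(g,h)\mapsto\alpha(g)(h)$ smooth, such that $\tau(\alpha(g)(h))=g\tau(h)g^{-1}$ and $\alpha(\tau(h))(h')=hh'h^{-1}$. The semidirect product $H\rtimes_\alpha G$ has product $(h_1,g_1)(h_2,g_2)=(h_1\alpha(g_1)(h_2),g_1g_2)$; $G$ and $H$ are identified with subgroups. $L(H\rtimes_\alpha G)=L(H)\oplus L(G)$ as a vector space, and $\mathrm{Ad}$ denotes the adjoint action of $H\rtimes_\alpha G$ on it; $\mathrm{Ad}(g)$ for $g\in G$ restricts to $d\alpha(g)|_e$ on $L(H)$. For $v\in T_pP$ and $g\in G$, $vg\in T_{pg}P$ is the image of $v$ under the derivative of $p\mapsto pg$. A vector is vertical if $\pi_*$ maps it to $0$. A form $\Theta$ on $P$ of degree $k$ ($k=1,2$) with values in $L(G)$ or $L(H)$ is equivariant if $\Theta_{pg}(v_1g,\dots,v_kg)=\mathrm{Ad}(g^{-1})\Theta_p(v_1,\dots,v_k)$ for all $g\in G$, and horizontal if it is $0$ whenever one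 of its arguments is vertical. $\mathcal{P}M$ is the set of $C^\infty$ paths $[t_0,t_1]\to M$ constant near $t_0$ and near $t_1$, with paths differing by a time translation identified. $\mathcal{P}_{\bar A}P$ is the set of $C^\infty$ paths $\bar\gamma:[t_0,t_1]\to P$, constant near $t_0$ and $t_1$, with $\bar A(\bar\gamma'(t))=0$ for all $t$, with the same identification. $T_{\bar\gamma}\mathcal{P}_{\bar A}P$ is the vector space of $C^\infty$ vector fields $\bar v$ along $\bar\gamma$, constant near $t_0$ and $t_1$, with $\frac{\partial}{\partial t}\bar A(\bar v(t))=F^{\bar A}(\bar\gamma'(t),\bar v(t))$, where $F^{\bar A}$ is the curvature of $\bar A$. The projection is $(\bar\gamma,h)\mapsto\pi\circ\bar\gamma$, and $T_{(\bar\gamma,h)}\mathcal{P}^{\rm dec}_{\bar A}P=T_{\bar\gamma}\mathcal{P}_{\bar A}P\oplus T_hH$, with elements written $\bar v+X$; $Xh^{-1}\in L(H)$ is the right translate of $X\in T_hH$. A path $s\mapsto(\tilde\Gamma_s,h_s)$ on $\mathcal{P}^{\rm dec}_{\bar A}P$ is given by a $C^\infty$ map $[t_0,t_1]\times[s_0,s_1]\to P$, $(t,s)\mapsto\tilde\Gamma_s(t)$, with each $\tilde\Gamma_s\in\mathcal{P}_{\bar A}P$, and a $C^\infty$ map $s\mapsto h_s\in H$; it is assumed that for $\Gamma_s=\pi\circ\tilde\Gamma_s$ there is $\epsilon>0$ such that for each $s$ the point $\Gamma_s(t)$ is constant for $t$ within $\epsilon$ of $t_0$, and for $t$ within $\epsilon$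 of $t_1$, and for each $t$ it is constant for $s$ within $\epsilon$ of $s_0$, and for $s$ within $\epsilon$ of $s_1$. Its tangent vector at $s$ is $\partial_s\tilde\Gamma_s+\dot h_s$, where $\partial_s\tilde\Gamma_s\in T_{\tilde\Gamma_s}\mathcal{P}_{\bar A}P$ is the vector field $t\mapsto\partial_s\tilde\Gamma_s(t)$ and $\dot h_s=\partial_sh_s$. The path is $\Omega$-horizontal if $\Omega$ vanishes on its tangent vector for every $s$, and $s\mapsto\tilde\Gamma_s$ is $\omega$-horizontal if $\omega_{\tilde\Gamma_s}(\partial_s\tilde\Gamma_s)=0$ for every $s$. *)

(* Defs.v *)
From HB Require Import structures.
From mathcomp Require Import all_boot all_order all_algebra.
From mathcomp Require Import all_classical all_reals all_analysis.

Set Implicit Arguments.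
Unset Strict Implicit.
Unset Printing Implicit Defensive.

Import Order.TTheory GRing.Theory Num.Theory numFieldNormedType.Exports.

Local Open Scope classical_set_scope.
Local Open Scope ring_scope.

(* Smooth manifolds from scratch: C^oo functions on open subsets of R^n,
   atlases, Lie groups, tangent vectors as derivations.  All manifolds are
   finite dimensional, Hausdorff and second countable. *)

Section Ck.
Context {R : realType}.

(* f is C^k at every point of the set U, which is meant to be open. *)
Fixpoint Ck n (k : nat) (U : set 'rV[R]_n) (f : 'rV[R]_n -> R) : Prop :=
  match k with
  | 0 => forall x, U x -> {for x, continuous f}
  | k'.+1 => (forall x, U x -> differentiable f x) /\
             (forall v, Ck k' U ('D_v f))
  end.

Definition Cinfty n (U : set 'rV[R]_n) (f : 'rV[R]_n -> R) :=
  forall k, Ck k U f.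

Lemma Ck_continuous n k (U : set 'rV[R]_n) f x :
  Ck k U f -> U x -> {for x, continuous f}.
Proof.
case: k => [|k] /=; first by apply.
by move=> [df _] Ux; apply: differentiable_continuous; apply: df.
Qed.

Lemma CkW n k (U : set 'rV[R]_n) f : Ck k.+1 U f -> Ck k U f.
Proof.
elim: k f => [|k IH] f; first by move=> df x Ux; apply: Ck_continuous df Ux.
by move=> [df Df]; split=> // v; apply: IH; apply: Df.
Qed.

Lemma Ck_local n k (U : set 'rV[R]_n) f :
  (forall x, U x -> exists W, [/\ open W, W x & Ck k W f]) -> Ck k U f.
Proof.
elim: k f => [|k IH] f Uf /=.
  by move=> x Ux; have [W [oW Wx fW]] := Uf x Ux; apply: fW.
split.
  by move=> x Ux; have [W [oW Wx [fW _]]] := Uf x Ux; apply: fW.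
move=> v; apply: IH => x Ux; have [W [oW Wx [_ fW]]] := Uf x Ux.
by exists W; split => //; exact: fW.
Qed.

Lemma Ck_subset n k (U V : set 'rV[R]_n) f : U `<=` V -> Ck k V f -> Ck k U f.
Proof.
move=> UV; elim: k f => [|k IH] f /=; first by move=> h x /UV; apply: h.
by move=> [h1 h2]; split=> [x /UV|v]; [apply: h1|apply: IH].
Qed.

Lemma near_eq_differentiable (V W : normedModType R) (f g : V -> W) (x : V) :
  (\near x, f x = g x) -> differentiable f x -> differentiable g x.
Proof.
move=> fg df; have [cf ef] := (diff_locallyP _ _).1 df.
have fgx : f x = g x by apply: (nbhs_singleton fg).
have eg : g \o shift x = cst (g x) + 'd f x +o_ 0 id.
  apply/eqaddoP => e e0; have /eqaddoP/(_ e e0) H := ef.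
  have fg0 : \forall y \near 0, f (y + x) = g (y + x).
    by move: fg; rewrite (near_shift 0 x) /= subr0.
  near=> y.
  have : `|(f \o shift x - (cst (f x) + 'd f x)) y| <= e * `|y| by near: y; exact: H.
  suff -> : (g \o shift x - (cst (g x) + 'd f x)) y = (f \o shift x - (cst (f x) + 'd f x)) y by [].
  change (g (y + x) - (g x + 'd f x y) = f (y + x) - (f x + 'd f x y)).
  rewrite fgx; congr (_ - _); apply/esym; near: y; exact: fg0.
apply/diff_locallyP; have -> := diff_unique cf eg; by split.
Unshelve. all: by end_near.
Qed.

Lemma Ck_eq n k (U : set 'rV[R]_n) f g :
  open U -> (forall x, U x -> f x = g x) -> Ck k U f -> Ck k U g.
Proof.
move=> oU; elim: k f g => [|k IH] f g fg.
  move=> cf x Ux; have := cf x Ux; rewrite /prop_for /continuous_at -(fg x Ux).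
  have gf : \forall y \near x, f y = g y.
    by near=> y; rewrite fg //; near: y; exact: open_nbhs_nbhs.
  by move=> h; exact: cvg_trans (near_eq_cvg gf) h.
have nU x : U x -> \near x, f x = g x.
  by move=> Ux; near=> y; apply: fg; near: y; exact: open_nbhs_nbhs.
move=> [df Df]; split=> [x Ux|v].
  exact: near_eq_differentiable (nU x Ux) (df x Ux).
apply: IH (Df v) => x Ux; exact: near_eq_derive (nU x Ux).
Unshelve. all: by end_near.
Qed.

Lemma Ck_cst n k (U : set 'rV[R]_n) (a : R) : Ck k U (cst a).
Proof.
elim: k a => [|k IH] a /=; first by move=> x _; apply: cst_continuous.
split=> [x _|v]; first exact: differentiable_cst.
have -> : 'D_v (cst a) = cst (0 : R) :> ('rV[R]_n -> R).
  by apply/funext => x; rewrite derive_cst.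
exact: IH.
Qed.

Lemma Ck_coord n k (U : set 'rV[R]_n) (j : 'I_n) : Ck k U (fun x => x 0 j).
Proof.
case: k => [|k] /=; first by move=> x _; apply: coord_continuous.
split=> [x _|v]; first exact: differentiable_coord.
have -> : 'D_v (fun x : 'rV[R]_n => x 0 j) = cst (v 0 j).
  apply/funext => x; have /derive_mx := @derivable_id _ 'rV[R]_n x v.
  rewrite derive_id => /(congr1 (fun M : 'rV[R]_n => M 0 j)).
  by rewrite mxE => <-.
exact: Ck_cst.
Qed.

Lemma Ck_add n k (U : set 'rV[R]_n) f g :
  open U -> Ck k U f -> Ck k U g -> Ck k U (fun x => f x + g x).
Proof.
move=> oU; elim: k f g => [|k IH] f g /=.
  by move=> cf cg x Ux; apply: continuousD; [exact: cf|exact: cg].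
move=> [df Df] [dg Dg]; split=> [x Ux|v].
  by apply: differentiableD; [exact: df|exact: dg].
apply: (Ck_eq oU) (IH _ _ (Df v) (Dg v)) => x Ux.
by rewrite deriveD //; apply: diff_derivable; [exact: df|exact: dg].
Qed.

Lemma Ck_mul n k (U : set 'rV[R]_n) f g :
  open U -> Ck k U f -> Ck k U g -> Ck k U (fun x => f x * g x).
Proof.
move=> oU; elim: k f g => [|k IH] f g; first move=> /=.
  by move=> cf cg x Ux; apply: continuousM; [exact: cf|exact: cg].
move=> Cf Cg; have /= [df Df] := Cf; have /= [dg Dg] := Cg; split=> [x Ux|v].
  by apply: differentiableM; [exact: df|exact: dg].
have H := Ck_add oU (IH _ _ (CkW Cf) (Dg v)) (IH _ _ (CkW Cg) (Df v)).
apply: (Ck_eq oU _ H) => x Ux.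
by rewrite deriveM //; apply: diff_derivable; [exact: df|exact: dg].
Qed.

Lemma Ck_sum n k (U : set 'rV[R]_n) m (f : 'I_m -> 'rV[R]_n -> R) :
  open U -> (forall i, Ck k U (f i)) -> Ck k U (fun x => \sum_i f i x).
Proof.
move=> oU Cf; elim: (index_enum _) => [|i r IH].
  by under eq_fun do rewrite big_nil; exact: Ck_cst.
by under eq_fun do rewrite big_cons; exact: Ck_add.
Qed.

Lemma differentiable_rV m n (F : 'rV[R]_m -> 'rV[R]_n) x :
  (forall j, differentiable (fun x => F x 0 j) x) -> differentiable F x.
Proof.
move=> dF.
have -> : F = \sum_j (fun x => F x 0 j *: delta_mx 0 j).
  apply/funext => y; rewrite fct_sumE; exact: row_sum_delta.
by apply: differentiable_sum => j; apply: differentiableZl; exact: dF.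
Qed.

Lemma Ck_comp m n k (U : set 'rV[R]_m) (V : set 'rV[R]_n)
    (F : 'rV[R]_m -> 'rV[R]_n) f :
  open U -> (forall x, U x -> V (F x)) ->
  (forall j, Cinfty U (fun x => F x 0 j)) -> Cinfty V f -> Ck k U (f \o F).
Proof.
move=> oU UV CF; elim: k f => [|k IH] f Cf.
  move=> x Ux; apply: continuous_comp; last exact: (Ck_continuous (Cf 0%N) (UV _ Ux)).
  apply: differentiable_continuous; apply: differentiable_rV => j.
  by case: (CF j 1%N) => + _; apply.
have dF x : U x -> differentiable F x.
  by move=> Ux; apply: differentiable_rV => j; case: (CF j 1%N) => + _; apply.
have df x : U x -> differentiable f (F x).
  by move=> /UV Vx; case: (Cf 1%N) => + _; apply.
split=> [x Ux|v]; first by apply: differentiable_comp; [exact: dF|exact: df].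
have H : Ck k U (fun x => \sum_j
    'D_v (fun y => F y 0 j) x * ('D_(delta_mx 0 j) f \o F) x).
  apply: (Ck_sum oU) => j; apply: (Ck_mul oU).
    by have [_] := CF j k.+1; apply.
  by apply: IH => l; have [_] := Cf l.+1; apply.
apply: (Ck_eq oU _ H) => x Ux /=.
rewrite (@deriveE _ _ _ (f \o F)); last by apply: differentiable_comp; [exact: dF|exact: df].
rewrite diff_comp; [|exact: dF|exact: df] => /=.
rewrite -(deriveE v (dF _ Ux)) derive_mx; last by apply: diff_derivable; exact: dF.
rewrite [X in 'd f (F x) X]row_sum_delta linear_sum; apply: eq_bigr => j _.
by rewrite linearZ mxE /= -deriveE //; exact: df.
Qed.
End Ck.

Section Manifold.
Context {R : realType}.

(* cinv is only meaningful on the open set (cfun @` cdom), where it is the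
   inverse of the homeomorphism cfun. *)
Record chart (T : topologicalType) n := Chart {
  cdom : set T;
  cfun : T -> 'rV[R]_n;
  cinv : 'rV[R]_n -> T;
  cdom_open : open cdom;
  cimg_open : open (cfun @` cdom);
  cfunK : forall x, cdom x -> cinv (cfun x) = x;
  cfun_continuous : forall x, cdom x -> {for x, continuous cfun};
  cinv_continuous : forall y, (cfun @` cdom) y -> {for y, continuous cinv} }.

Record manifold := Manifold {
  carrier :> topologicalType;
  dim : nat;
  atlas : set (chart carrier dim);
  atlas_cover : forall x, exists2 c, atlas c & cdom c x;
  atlas_compatible : forall c d, atlas c -> atlas d -> forall j,
    Cinfty (cfun c @` (cdom c `&` cdom d)) (fun y => cfun d (cinv c y) 0 j);
  manifold_hausdorff : hausdorff_space carrier;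
  manifold_second_countable : @second_countable carrier }.

(* Intended for open W. *)
Definition smooth_on (M N : manifold) (W : set M) (f : M -> N) :=
  (forall x, W x -> {for x, continuous f}) /\
  forall c d, atlas c -> atlas d -> forall j,
    Cinfty (cfun c @` (W `&` cdom c `&` f @^-1` cdom d))
      (fun y => cfun d (f (cinv c y)) 0 j).

(* Smoothness on an arbitrary subset D, e.g. a closed interval or rectangle:
   local extendability to a smooth map on an open set. *)
Definition smooth_within (M N : manifold) (D : set M) (f : M -> N) :=
  forall x, D x -> exists (W : set M) (g : M -> N),
    [/\ open W, W x, smooth_on W g & forall y, D y -> W y -> g y = f y].

Definition smooth (M N : manifold) (f : M -> N) := smooth_on setT f.

Lemma cimg_openI (T : topologicalType) n (c : chart T n) (W : set T) :
  open W -> open (cfun c @` (cdom c `&` W)).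
Proof.
move=> oW; rewrite openE => _ [x [cx Wx] <-].
rewrite /interior /=; near=> y.
have [z cz zy] : (cfun c @` cdom c) y.
  near: y; apply: open_nbhs_nbhs; split; first exact: cimg_open.
  by exists x.
exists z => //; split=> //; rewrite -(cfunK cz) zy; near: y.
have /(_ W) := @cinv_continuous _ _ c (cfun c x) (ex_intro2 _ _ x cx erefl).
by rewrite /= cfunK //; apply; exact: open_nbhs_nbhs.
Unshelve. all: by end_near.
Qed.

Lemma open_preimage (S T : topologicalType) (U : set S) (V : set T) (f : S -> T) :
  open U -> open V -> (forall x, U x -> {for x, continuous f}) ->
  open (U `&` f @^-1` V).
Proof.
move=> oU oV cf; rewrite openE => x [Ux Vfx]; rewrite /interior; near=> y; split.
  by near: y; exact: open_nbhs_nbhs.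
by near: y; apply: (cf _ Ux); exact: open_nbhs_nbhs.
Unshelve. all: by end_near.
Qed.

Lemma smooth_on_comp (M N Q : manifold) (U : set M) (V : set N)
    (f : M -> N) (g : N -> Q) : open U -> open V ->
  smooth_on U f -> smooth_on V g -> smooth_on (U `&` f @^-1` V) (g \o f).
Proof.
move=> oU oV [cf sf] [cg sg]; split.
  by move=> x [/cf ? /cg ?]; exact: continuous_comp.
move=> c e ac ae j k; apply: Ck_local => _ [x [[[Ux Vfx] cx] /= ex] <-].
have [d ad dfx] := atlas_cover (f x).
pose W := U `&` f @^-1` (V `&` cdom d `&` g @^-1` cdom e).
have oVe : open (V `&` g @^-1` cdom e).
  by apply: open_preimage => //; exact: cdom_open.
have oW : open W.
  apply: open_preimage => //; rewrite setIAC; apply: openI => //; exact: cdom_open.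
exists (cfun c @` (cdom c `&` W)); split; first exact: cimg_openI.
  by exists x.
have oI := cimg_openI (c := c) oW.
have H : Ck k (cfun c @` (cdom c `&` W))
    ((fun z => cfun e (g (cinv d z)) 0 j) \o (fun y => cfun d (f (cinv c y)))).
  apply: Ck_comp oI _ _ (sg d e ad ae j).
  - move=> _ [y [cy [Uy [[Vfy dfy] /= efy]]] <-].
    by exists (f (cinv c (cfun c y))); rewrite cfunK.
  - move=> i l; apply: Ck_subset (sf c d ac ad i l).
    by move=> _ [y [cy [Uy [[Vfy dfy] /= efy]]] <-]; exists y.
apply: (Ck_eq oI) H => _ [y [cy [Uy [[Vfy dfy] /= efy]]] <-].
by rewrite /= !cfunK.
Qed.

Lemma smooth_comp (M N Q : manifold) (f : M -> N) (g : N -> Q) :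
  smooth f -> smooth g -> smooth (g \o f).
Proof.
move=> sf sg; have := smooth_on_comp openT openT sf sg.
by rewrite preimage_setT setTI.
Qed.

Lemma smooth_cst (M N : manifold) (a : N) : smooth (fun _ : M => a).
Proof.
split=> [x _|c d ac ad j]; first exact: cst_continuous.
move=> k; exact: Ck_cst.
Qed.

Lemma smooth_id (M : manifold) : smooth (fun x : M => x).
Proof.
split=> [x _|c d ac ad j]; first exact: cvg_id.
by rewrite setTI; exact: atlas_compatible.
Qed.

Lemma second_countable_R : @second_countable R.
Proof.
exists (range (fun pq : rat * rat => `](ratr pq.1 : R), (ratr pq.2 : R)[%classic)).
  by apply: sub_countable; first exact: card_image_le.
split; first by move=> _ [pq _ <-]; exact: interval_open.
move=> x A /= /nbhs_ballP[e /= e0 xA].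
have [p px] : exists p : rat, ratr p \in `](x - e), x[ by apply: rat_in_itvoo; rewrite gtrBl.
have [q qx] : exists q : rat, ratr q \in `]x, (x + e)[ by apply: rat_in_itvoo; rewrite ltrDl.
move: px qx; rewrite !in_itv /= => /andP[p1 p2] /andP[q1 q2].
exists `](ratr p : R), (ratr q : R)[%classic => /=.
  by split; [exists (p, q)|rewrite in_itv /= p2 q1].
move=> y /=; rewrite in_itv /= => /andP[py yq]; apply: xA => /=.
rewrite /ball /= ltr_distlC (lt_trans p1 py) /=.
exact: lt_trans yq q2.
Qed.

Lemma second_countable_prod (S T : topologicalType) :
  @second_countable S -> @second_countable T -> @second_countable (S * T)%type.
Proof.
move=> [B cB [oB bB]] [C cC [oC bC]].
exists ((fun p => p.1 `*` p.2) @` (B `*` C)).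
  apply: sub_countable; first exact: card_image_le.
  exact: countableX.
split=> [_ [[U V] /= [BU CV] <-]|[x y] A].
  rewrite openE => -[x y] [/= Ux Vy]; exists (U, V) => //=.
  by split; apply: open_nbhs_nbhs; split=> //; [exact: oB|exact: oC].
move=> [[P Q] /= [nP nQ] PQ].
have [U [BU Ux] UP] := bB x P nP; have [V [CV Vy] VQ] := bC y Q nQ.
exists (U `*` V) => //=; first by split=> //; exists (U, V).
by move=> [a b] [/= /UP ? /VQ ?]; apply: PQ.
Qed.

Lemma hausdorff_prod (S T : topologicalType) :
  hausdorff_space S -> hausdorff_space T -> hausdorff_space (S * T)%type.
Proof.
move=> hS hT [a b] [c d] cl; congr pair.
  apply: hS => A B nA nB.
  have [] := cl (A `*` setT) (B `*` setT).
  - by exists (A, setT) => //=; split=> //; exact: filterT.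
  - by exists (B, setT) => //=; split=> //; exact: filterT.
  by move=> [x y] [[/= ? _] [/= ? _]]; exists x.
apply: hT => A B nA nB.
have [] := cl (setT `*` A) (setT `*` B).
- by exists (setT, A) => //=; split=> //; exact: filterT.
- by exists (setT, B) => //=; split=> //; exact: filterT.
by move=> [x y] [[/= _ ?] [/= _ ?]]; exists y.
Qed.

Lemma eq_continuous_at (S T : topologicalType) (f g : S -> T) x :
  (forall y, f y = g y) -> {for x, continuous f} -> {for x, continuous g}.
Proof. by move=> /funext ->. Qed.

Lemma continuous_mx (T : topologicalType) m n (F : T -> 'M[R]_(m, n)) x :
  (forall i j, {for x, continuous (fun y => F y i j)}) -> {for x, continuous F}.
Proof.
move=> cF A [P nP PA]; rewrite /= nbhs_simpl.
have H : \forall y \near x, forall ij : 'I_m * 'I_n, P ij.1 ij.2 (F y ij.1 ij.2).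
  by apply: filter_forall => -[i j] /=; apply: cF; exact: nP.
by apply: filterS H => y H; apply: PA => i j; exact: (H (i, j)).
Qed.

Lemma Ck_row_mx m n p k (U : set 'rV[R]_m) (f : 'rV[R]_m -> 'rV[R]_n)
    (g : 'rV[R]_m -> 'rV[R]_p) :
  (forall j, Ck k U (fun y => f y 0 j)) -> (forall j, Ck k U (fun y => g y 0 j)) ->
  forall j, Ck k U (fun y => row_mx (f y) (g y) 0 j).
Proof.
move=> Cf Cg j; case: (split_ordP j) => i ->.
  by under eq_fun do rewrite row_mxEl.
by under eq_fun do rewrite row_mxEr.
Qed.

Section line.
Let fn (x : R) : 'rV[R]_1 := const_mx x.
Let inv (v : 'rV[R]_1) : R := v 0 0.

Let img : fn @` setT = setT.
Proof.
rewrite eqEsubset; split=> // v _; exists (v 0 0) => //.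
by apply/rowP => i; rewrite mxE ord1.
Qed.

Let img_open : open (fn @` setT). Proof. by rewrite img; exact: openT. Qed.

Let cfunK x : setT x -> inv (fn x) = x. Proof. by rewrite /inv mxE. Qed.

Let cfun_cont x : setT x -> {for x, continuous fn}.
Proof.
move=> _; apply: continuous_mx => i j.
by apply: (@eq_continuous_at _ _ id) => [y|]; [rewrite mxE|exact: cvg_id].
Qed.

Let cinv_cont v : (fn @` setT) v -> {for v, continuous inv}.
Proof. by move=> _; exact: coord_continuous. Qed.

Definition line_chart : chart R 1 :=
  Chart openT img_open cfunK cfun_cont cinv_cont.

Let cover x : exists2 c, [set line_chart] c & cdom c x.
Proof. by exists line_chart. Qed.

Let compat c d : [set line_chart] c -> [set line_chart] d -> forall j,
  Cinfty (cfun c @` (cdom c `&` cdom d)) (fun y => cfun d (cinv c y) 0 j).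
Proof.
move=> -> -> j k /=; under eq_fun do rewrite mxE; exact: Ck_coord.
Qed.

Definition line : manifold :=
  Manifold cover compat (@Rhausdorff R) second_countable_R.
End line.

Section product.

Section chart.
Context (S T : topologicalType) m n (c : chart S m) (d : chart T n).
Let dom := cdom c `*` cdom d.
Let fn (p : S * T) := row_mx (cfun c p.1) (cfun d p.2).
Let inv (v : 'rV[R]_(m + n)) := (cinv c (lsubmx v), cinv d (rsubmx v)).

Let dom_open : open dom.
Proof.
rewrite openE => -[x y] [/= cx dy]; exists (cdom c, cdom d) => //=.
by split; apply: open_nbhs_nbhs; split=> //; exact: cdom_open.
Qed.

Let img : fn @` dom = lsubmx @^-1` (cfun c @` cdom c) `&` rsubmx @^-1` (cfun d @` cdom d).
Proof.
rewrite eqEsubset; split=> [_ [[x y] [/= cx dy] <-]|v [[x cx xv] [y dy yv]]].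
  by split; rewrite /fn /= ?row_mxKl ?row_mxKr; [exists x|exists y].
by exists (x, y) => //; rewrite /fn /= xv yv hsubmxK.
Qed.

Let img_open : open (fn @` dom).
Proof.
rewrite img; apply: openI; apply: open_comp => [x _|]; [|exact: cimg_open| |exact: cimg_open].
- exact: continuous_lsubmx.
- exact: continuous_rsubmx.
Qed.

Let fnK p : dom p -> inv (fn p) = p.
Proof.
by case: p => x y [/= cx dy]; rewrite /inv /fn /= row_mxKl row_mxKr !cfunK.
Qed.

Let fn_cont p : dom p -> {for p, continuous fn}.
Proof.
case: p => x y [/= cx dy]; apply: continuous_mx => i j.
rewrite (ord1 i); case: (split_ordP j) => l ->.
  apply: (@eq_continuous_at _ _ (fun p0 : S * T => cfun c p0.1 0 l)) => [p0|].
    by rewrite /fn row_mxEl.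
  apply: (@continuous_comp _ _ _ (fun p0 : S * T => cfun c p0.1) (fun v : 'rV_m => v 0 l)).
    by apply: (@continuous_comp _ _ _ fst (cfun c)); [exact: cvg_fst|exact: cfun_continuous].
  exact: coord_continuous.
apply: (@eq_continuous_at _ _ (fun p0 : S * T => cfun d p0.2 0 l)) => [p0|].
  by rewrite /fn row_mxEr.
apply: (@continuous_comp _ _ _ (fun p0 : S * T => cfun d p0.2) (fun v : 'rV_n => v 0 l)).
  by apply: (@continuous_comp _ _ _ snd (cfun d)); [exact: cvg_snd|exact: cfun_continuous].
exact: coord_continuous.
Qed.

Let inv_cont v : (fn @` dom) v -> {for v, continuous inv}.
Proof.
rewrite img => -[cv dv].
have c1 : {for v, continuous (fun w => cinv c (lsubmx w))}.
  apply: (@continuous_comp _ _ _ (lsubmx : 'rV_(m + n) -> 'rV_m) (cinv c)).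
    exact: continuous_lsubmx.
  exact: cinv_continuous.
have c2 : {for v, continuous (fun w => cinv d (rsubmx w))}.
  apply: (@continuous_comp _ _ _ (rsubmx : 'rV_(m + n) -> 'rV_n) (cinv d)).
    exact: continuous_rsubmx.
  exact: cinv_continuous.
exact: cvg_pair c1 c2.
Qed.

Definition prod_chart : chart (S * T)%type (m + n) :=
  Chart dom_open img_open fnK fn_cont inv_cont.
End chart.

Context (M N : manifold).

Definition prod_atlas : set (chart (M * N)%type (dim M + dim N)) :=
  [set e | exists c d, [/\ atlas c, atlas d & e = prod_chart c d]].

Let cover x : exists2 e, prod_atlas e & cdom e x.
Proof.
have [c ac cx] := atlas_cover x.1; have [d ad dx] := atlas_cover x.2.
by exists (prod_chart c d) => //; exists c, d.
Qed.

Let compat e e' : prod_atlas e -> prod_atlas e' -> forall j,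
  Cinfty (cfun e @` (cdom e `&` cdom e')) (fun y => cfun e' (cinv e y) 0 j).
Proof.
move=> [c [d [ac ad ->]]] [c' [d' [ac' ad' ->]]] j k.
set U := (X in Ck k X _).
have oU : open U by apply: cimg_openI; exact: cdom_open.
apply: Ck_row_mx => i /=.
  have H := atlas_compatible ac ac' i.
  apply: (Ck_comp (F := lsubmx) k oU _ _ H) => [_ [[x y] [[/= cx dy] [/= c'x d'y]] <-]|l k'].
    by rewrite row_mxKl; exists x.
  by under eq_fun do rewrite mxE; exact: Ck_coord.
have H := atlas_compatible ad ad' i.
apply: (Ck_comp (F := rsubmx) k oU _ _ H) => [_ [[x y] [[/= cx dy] [/= c'x d'y]] <-]|l k'].
  by rewrite row_mxKr; exists y.
by under eq_fun do rewrite mxE; exact: Ck_coord.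
Qed.

Definition prodM : manifold := Manifold cover compat
  (hausdorff_prod (@manifold_hausdorff M) (@manifold_hausdorff N))
  (second_countable_prod (@manifold_second_countable M) (@manifold_second_countable N)).

Lemma smooth_fst : @smooth prodM M fst.
Proof.
split=> [p _|_ c' [c [d [ac ad ->]]] ac' j k]; first exact: cvg_fst.
have H := atlas_compatible ac ac' j.
have oI : open (cfun (prod_chart c d) @` (cdom (prod_chart c d) `&` fst @^-1` cdom c')).
  apply: cimg_openI; apply: open_comp => [? _|]; [exact: cvg_fst|exact: cdom_open].
apply: Ck_local => v [[x y] [[_ [/= cx dy]] /= c'x] xyv].
exists (cfun (prod_chart c d) @` (cdom (prod_chart c d) `&` fst @^-1` cdom c')); split=> //.
  by exists (x, y).
apply: (Ck_comp (F := lsubmx) k oI _ _ H) => [_ [[x' y'] [[/= cx' dy'] /= c'x'] <-]|l k'].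
  by rewrite row_mxKl; exists x'.
by under eq_fun do rewrite mxE; exact: Ck_coord.
Qed.

Lemma smooth_snd : @smooth prodM N snd.
Proof.
split=> [p _|_ d' [c [d [ac ad ->]]] ad' j k]; first exact: cvg_snd.
have H := atlas_compatible ad ad' j.
have oI : open (cfun (prod_chart c d) @` (cdom (prod_chart c d) `&` snd @^-1` cdom d')).
  apply: cimg_openI; apply: open_comp => [? _|]; [exact: cvg_snd|exact: cdom_open].
apply: Ck_local => v [[x y] [[_ [/= cx dy]] /= c'x] xyv].
exists (cfun (prod_chart c d) @` (cdom (prod_chart c d) `&` snd @^-1` cdom d')); split=> //.
  by exists (x, y).
apply: (Ck_comp (F := rsubmx) k oI _ _ H) => [_ [[x' y'] [[/= cx' dy'] /= c'x'] <-]|l k'].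
  by rewrite row_mxKr; exists y'.
by under eq_fun do rewrite mxE; exact: Ck_coord.
Qed.

Lemma smooth_pair (Q : manifold) (f : Q -> M) (g : Q -> N) :
  smooth f -> smooth g -> @smooth Q prodM (fun x => (f x, g x)).
Proof.
move=> [cf sf] [cg sg]; split=> [x _|e _ ae [c [d [ac ad ->]]] j k].
  by apply: cvg_pair; [exact: cf|exact: cg].
apply: Ck_row_mx => i.
  apply: Ck_subset (sf e c ae ac i k) => _ [x [[_ ex] [/= cx dx]] <-].
  by exists x.
apply: Ck_subset (sg e d ae ad i k) => _ [x [[_ ex] [/= cx dx]] <-].
by exists x.
Qed.

End product.

End Manifold.

Arguments manifold : clear implicits.
Arguments line : clear implicits.

Section LieGroup.
Context {R : realType}.

Record lieGroup := LieGroup {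
  lie_manifold :> manifold R;
  lmul : lie_manifold -> lie_manifold -> lie_manifold;
  lone : lie_manifold;
  linv : lie_manifold -> lie_manifold;
  lmulA : forall x y z, lmul x (lmul y z) = lmul (lmul x y) z;
  lmul1 : forall x, lmul lone x = x;
  lmulV : forall x, lmul (linv x) x = lone;
  lmul_smooth : @smooth _ (prodM lie_manifold lie_manifold) lie_manifold
                  (fun p => lmul p.1 p.2);
  linv_smooth : smooth linv }.

End LieGroup.

Arguments lieGroup : clear implicits.
Arguments lone {R} l.

Declare Scope lie_scope.
Delimit Scope lie_scope with lie.
Notation "1" := (lone _) : lie_scope.
Notation "x * y" := (lmul x y) : lie_scope.
Notation "x ^-1" := (linv x) : lie_scope.

Section CrossedModule.
Context {R : realType}.

Record crossedModule (G H : lieGroup R) := CrossedModule {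
  alpha : G -> H -> H;
  tau : H -> G;
  tauM : forall h k, tau (h * k)%lie = (tau h * tau k)%lie;
  tau_smooth : smooth tau;
  alpha_bij : forall g, bijective (alpha g);
  alpha_mulr : forall g h k, alpha g (h * k)%lie = (alpha g h * alpha g k)%lie;
  alpha_mull : forall g g' h, alpha (g * g')%lie h = alpha g (alpha g' h);
  alpha_smooth : @smooth _ (prodM G H) H (fun p => alpha p.1 p.2);
  tau_alpha : forall g h, tau (alpha g h) = (g * tau h * g^-1)%lie;
  alpha_tau : forall h k, alpha (tau h) k = (h * k * h^-1)%lie }.

Section semidirect.
Context (G H : lieGroup R) (X : crossedModule G H).
Let HG := prodM H G.

Definition sd_mul (x y : HG) : HG := (x.1 * alpha X x.2 y.1, x.2 * y.2)%lie.
Definition sd_one : HG := (1, 1)%lie.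
Definition sd_inv (x : HG) : HG := (alpha X x.2^-1 x.1^-1, x.2^-1)%lie.

Lemma alpha1 h : alpha X 1%lie h = h.
Proof.
have [f fK _] := alpha_bij X 1%lie.
by apply: (can_inj fK); rewrite -alpha_mull lmul1.
Qed.

Lemma lmul_idem (K : lieGroup R) (x : K) : (x * x)%lie = x -> x = 1%lie.
Proof. by move=> xx; rewrite -(lmulV x) -{3}xx lmulA lmulV lmul1. Qed.

Lemma alphag1 g : alpha X g 1%lie = 1%lie.
Proof. by apply: lmul_idem; rewrite -alpha_mulr lmul1. Qed.

Lemma sd_mulA x y z : sd_mul x (sd_mul y z) = sd_mul (sd_mul x y) z.
Proof. by rewrite /sd_mul /= alpha_mulr alpha_mull !lmulA. Qed.

Lemma sd_mul1 x : sd_mul sd_one x = x.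
Proof. by case: x => h g; rewrite /sd_mul /= alpha1 !lmul1. Qed.

Lemma sd_mulV x : sd_mul (sd_inv x) x = sd_one.
Proof. by rewrite /sd_mul /sd_inv /= -alpha_mulr !lmulV alphag1. Qed.

Lemma smooth_alpha (M : manifold R) (f : M -> G) (k : M -> H) :
  smooth f -> smooth k -> smooth (fun x => alpha X (f x) (k x)).
Proof. by move=> sf sk; exact: smooth_comp (smooth_pair sf sk) (alpha_smooth X). Qed.

Lemma smooth_lmul (M : manifold R) (K : lieGroup R) (f k : M -> K) :
  smooth f -> smooth k -> smooth (fun x => f x * k x)%lie.
Proof. by move=> sf sk; exact: smooth_comp (smooth_pair sf sk) (lmul_smooth K). Qed.

Lemma smooth_linv (M : manifold R) (K : lieGroup R) (f : M -> K) :
  smooth f -> smooth (fun x => (f x)^-1)%lie.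
Proof. by move=> sf; exact: smooth_comp sf (linv_smooth K). Qed.

Lemma sd_mul_smooth : @smooth _ (prodM HG HG) HG (fun p => sd_mul p.1 p.2).
Proof.
have s11 := smooth_comp (smooth_fst HG HG) (smooth_fst H G).
have s12 := smooth_comp (smooth_fst HG HG) (smooth_snd H G).
have s21 := smooth_comp (smooth_snd HG HG) (smooth_fst H G).
have s22 := smooth_comp (smooth_snd HG HG) (smooth_snd H G).
exact: smooth_pair (smooth_lmul s11 (smooth_alpha s12 s21)) (smooth_lmul s12 s22).
Qed.

Lemma sd_inv_smooth : smooth sd_inv.
Proof.
have s1 := smooth_linv (smooth_fst H G); have s2 := smooth_linv (smooth_snd H G).
exact: smooth_pair (smooth_alpha s2 s1) s2.
Qed.

Definition semidirect : lieGroup R :=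
  LieGroup sd_mulA sd_mul1 sd_mulV sd_mul_smooth sd_inv_smooth.
End semidirect.
End CrossedModule.

Section Tangent.
Context {R : realType}.

Definition smoothR (M : manifold R) (f : M -> R) := @smooth _ M (line R) f.

(* Tangent vectors are derivations of C^oo(M).  To keep the type independent of
   the base point and of smoothness proofs they are functionals on all functions
   M -> R, required to vanish on the functions which are not smooth; T_pM is the
   set of those v with (tangent p v). *)
Definition vec (M : manifold R) := (M -> R) -> R.

HB.instance Definition _ (M : manifold R) :=
  GRing.Lmodule.copy (vec M) ((M -> R) -> R).

Definition tangent (M : manifold R) (p : M) (v : vec M) :=
  [/\ forall a (f g : M -> R), smoothR f -> smoothR g ->
        v (a *: f + g) = a * v f + v g,
      forall f g : M -> R, smoothR f -> smoothR g ->
        v (f * g) = v f * g p + f p * v g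
    & forall f, ~ smoothR f -> v f = 0].

(* The derivative f_* v of a smooth map f. *)
Definition push (M N : manifold R) (f : M -> N) (v : vec M) : vec N :=
  fun phi => if `[< smoothR phi >] then v (phi \o f) else 0.

(* c'(t) for a smooth path c : [a, b] -> M and t in [a, b] (one-sided at a
   and b). *)
Definition velocity (M : manifold R) (a b : R) (c : R -> M) (t : R) : vec M :=
  fun phi => if `[< smoothR phi >]
    then lim ((phi (c u) - phi (c t)) / (u - t) @[u --> within `[a, b] t^'])
    else 0.

(* The integral of a function with values in a fixed (finite-dimensional)
   tangent space, taken componentwise. *)
Definition vint (M : manifold R) (a b : R) (F : R -> vec M) : vec M :=
  fun phi => \int[lebesgue_measure]_(t in `[a, b]) F t phi.

Definition smooth_vfield (M : manifold R) (X : M -> vec M) :=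
  (forall p, tangent p (X p)) /\
  (forall phi, smoothR phi -> smoothR (fun p => X p phi)).

Definition lconj (G : lieGroup R) (g x : G) : G := (g * x * g^-1)%lie.

(* L(G) is T_1 G, i.e. the v with (tangent 1 v). *)
Definition Ad (G : lieGroup R) (g : G) : vec G -> vec G := push (lconj g).

End Tangent.

Section Bundle.
Context {R : realType}.

(* In local_trivialization, (proj, theta) is a G-equivariant diffeomorphism from
   the part of P over U onto U x G, with inverse psi. *)
Record principalBundle (G : lieGroup R) (P M : manifold R) := PrincipalBundle {
  proj : P -> M;
  act : P -> G -> P;
  proj_smooth : smooth proj;
  act_smooth : @smooth _ (prodM P G) P (fun q => act q.1 q.2);
  act1 : forall p, act p 1%lie = p;
  actM : forall p g k, act p (g * k)%lie = act (act p g) k;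
  proj_act : forall p g, proj (act p g) = proj p;
  local_trivialization : forall x : M,
    exists (U : set M) (theta : P -> G) (psi : prodM M G -> P),
      [/\ open U, U x, smooth_on (proj @^-1` U) theta,
          @smooth_on _ (prodM M G) P (U `*` setT) psi &
      [/\ forall p, U (proj p) -> psi (proj p, theta p) = p,
          forall y g, U y -> proj (psi (y, g)) = y /\ theta (psi (y, g)) = g &
          forall p g, U (proj p) -> theta (act p g) = (theta p * g)%lie ]] }.

Section forms.
Context (G : lieGroup R) (P M : manifold R) (E : principalBundle G P M).

(* Forms on P with values in L(K) for a Lie group K; only their values on
   tangent vectors matter. *)
Definition form1 (K : lieGroup R) := P -> vec P -> vec K.
Definition form2 (K : lieGroup R) := P -> vec P -> vec P -> vec K.

Definition is_form1 (K : lieGroup R) (T : form1 K) :=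
  [/\ forall p v, tangent p v -> tangent 1%lie (T p v),
      forall p a v w, tangent p v -> tangent p w ->
        T p (a *: v + w) = a *: T p v + T p w
    & forall X phi, smooth_vfield X -> smoothR phi ->
        smoothR (fun p => T p (X p) phi)].

Definition is_form2 (K : lieGroup R) (T : form2 K) :=
  [/\ forall p v w, tangent p v -> tangent p w -> tangent 1%lie (T p v w),
      forall p a v w u, tangent p v -> tangent p w -> tangent p u ->
        T p (a *: v + w) u = a *: T p v u + T p w u /\
        T p u (a *: v + w) = a *: T p u v + T p u w,
      forall p v, tangent p v -> T p v v = 0
    & forall X Y phi, smooth_vfield X -> smooth_vfield Y -> smoothR phi ->
        smoothR (fun p => T p (X p) (Y p) phi)].

(* v |-> vg *)
Definition vact (v : vec P) (g : G) : vec P := push (fun p => act E p g) v.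

(* rho is the action of G on L(K): Ad for K = G, and d(alpha g)|_1 for K = H. *)
Definition equivariant1 (K : lieGroup R) (rho : G -> vec K -> vec K)
    (T : form1 K) :=
  forall p g v, tangent p v ->
    T (act E p g) (vact v g) = rho g^-1%lie (T p v).

Definition equivariant2 (K : lieGroup R) (rho : G -> vec K -> vec K)
    (T : form2 K) :=
  forall p g v w, tangent p v -> tangent p w ->
    T (act E p g) (vact v g) (vact w g) = rho g^-1%lie (T p v w).

Definition vertical (v : vec P) := push (proj E) v = 0.

Definition horizontal1 (K : lieGroup R) (T : form1 K) :=
  forall p v, tangent p v -> vertical v -> T p v = 0.

Definition horizontal2 (K : lieGroup R) (T : form2 K) :=
  forall p v w, tangent p v -> tangent p w -> vertical v \/ vertical w ->
    T p v w = 0.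

Definition connection_form (A : form1 G) :=
  [/\ is_form1 A, equivariant1 (@Ad R G) A
    & forall p xi, tangent 1%lie xi -> A p (push (act E p) xi) = xi].

Definition eqhor_form1 (K : lieGroup R) (rho : G -> vec K -> vec K)
    (T : form1 K) :=
  [/\ is_form1 T, equivariant1 rho T & horizontal1 T].

Definition eqhor_form2 (K : lieGroup R) (rho : G -> vec K -> vec K)
    (T : form2 K) :=
  [/\ is_form2 T, equivariant2 rho T & horizontal2 T].
End forms.
End Bundle.

Section PathSpace.
Context {R : realType}.

(* Elements of the path spaces are handled through representatives
   c : [t0, t1] -> P; c is a total function of which only the restriction to
   [t0, t1] is used.  Time translates are not identified: the notions below do
   not depend on the representative. *)
Definition near_constant (T : Type) (a b : R) (c : R -> T) (e : R) :=
  (forall t, a <= t <= b -> t <= a + e -> c t = c a) /\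
  (forall t, a <= t <= b -> b - e <= t -> c t = c b).

Context (G : lieGroup R) (P M : manifold R) (E : principalBundle G P M).

(* c represents an element of P_{Abar}P. *)
Definition hor_path (Abar : form1 P G) (t0 t1 : R) (c : R -> P) :=
  [/\ @smooth_within _ (line R) P `[t0, t1] c,
      exists2 e, 0 < e & near_constant t0 t1 c e
    & forall t, t0 <= t <= t1 -> Abar (c t) (velocity t0 t1 c t) = 0].

(* omega_c(v), for a field v of vectors along c.  The formula makes sense for
   every such field, so the linear condition cutting out T_c P_{Abar}P is not
   imposed on v here. *)
Definition omega (A C0L C0R : form1 P G) (B0 : form2 P G) (t0 t1 : R)
    (c : R -> P) (v : R -> vec P) : vec G :=
  A (c t0) (v t0) + C0R (c t1) (v t1) - C0L (c t0) (v t0)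
  + vint t0 t1 (fun t => B0 (c t) (v t) (velocity t0 t1 c t)).

Section decorated.
Context (H : lieGroup R) (X : crossedModule G H).

(* The inclusions of L(H) and L(G) in L(H x| G) = L(H) (+) L(G). *)
Definition inclH : vec H -> vec (semidirect X) :=
  push (fun h : H => (h, 1%lie) : semidirect X).
Definition inclG : vec G -> vec (semidirect X) :=
  push (fun g : G => (1%lie, g) : semidirect X).

(* Y |-> Y h^-1, from T_h H to L(H). *)
Definition rtransl (h : H) (Y : vec H) : vec H :=
  push (fun k => k * h^-1)%lie Y.

(* Omega_(c, h)(v + Y), with Y in T_h H. *)
Definition Omega (A C0L C0R : form1 P G) (B0 : form2 P G)
    (C1L C1R : form1 P H) (B1 : form2 P H) (t0 t1 : R)
    (c : R -> P) (h : H) (v : R -> vec P) (Y : vec H) : vec (semidirect X) :=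
  @Ad _ (semidirect X) (h^-1, 1)%lie
    (inclG (omega A C0L C0R B0 t0 t1 c v)
     + inclH (C1R (c t1) (v t1) - C1L (c t0) (v t0)
              + vint t0 t1 (fun t => B1 (c t) (v t) (velocity t0 t1 c t))
              + rtransl h Y)).

(* The path s |-> (Gam (., s), h s), for s in [s0, s1]. *)
Definition decorated_path (Abar : form1 P G) (t0 t1 s0 s1 : R)
    (Gam : R * R -> P) (h : R -> H) :=
  [/\ @smooth_within _ (prodM (line R) (line R)) P
        (`[t0, t1] `*` `[s0, s1]) Gam,
      forall s, s0 <= s <= s1 -> hor_path Abar t0 t1 (fun t => Gam (t, s)),
      @smooth_within _ (line R) H `[s0, s1] h
    & exists2 e, 0 < e &
        (forall s, s0 <= s <= s1 ->
          near_constant t0 t1 (fun t => proj E (Gam (t, s))) e) /\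
        (forall t, t0 <= t <= t1 ->
          near_constant s0 s1 (fun s => proj E (Gam (t, s))) e)].

(* The field t |-> d/ds Gam (t, s) along Gam (., s). *)
Definition ds (s0 s1 : R) (Gam : R * R -> P) (s t : R) : vec P :=
  velocity s0 s1 (fun s' => Gam (t, s')) s.

Definition omega_horizontal (A C0L C0R : form1 P G) (B0 : form2 P G)
    (t0 t1 s0 s1 : R) (Gam : R * R -> P) :=
  forall s, s0 <= s <= s1 ->
    omega A C0L C0R B0 t0 t1 (fun t => Gam (t, s)) (ds s0 s1 Gam s) = 0.

Definition Omega_horizontal (A C0L C0R : form1 P G) (B0 : form2 P G)
    (C1L C1R : form1 P H) (B1 : form2 P H)
    (t0 t1 s0 s1 : R) (Gam : R * R -> P) (h : R -> H) :=
  forall s, s0 <= s <= s1 ->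
    Omega A C0L C0R B0 C1L C1R B1 t0 t1 (fun t => Gam (t, s)) (h s)
      (ds s0 s1 Gam s) (velocity s0 s1 h s) = 0.
End decorated.
End PathSpace.

(* Main.v *)
Require Import Defs.
From HB Require Import structures.
From mathcomp Require Import all_boot all_order all_algebra.
From mathcomp Require Import all_classical all_reals all_analysis.
From mathcomp Require Import ring lra.

Import Order.TTheory GRing.Theory Num.Theory numFieldNormedType.Exports.

Local Open Scope classical_set_scope.
Local Open Scope ring_scope.

(** Pointwise in s, the value of Omega is Ad(h^-1) applied to a + b, where a in
    L(G) is the value of omega on the tangent vector of the path and b in L(H)
    is the bracket of C_1 and B_1 terms plus the right translate of the
    derivative of h.  Ad of a group element is a linear bijection, so Omega
    vanishes iff a + b does; as L(H x| G) is the direct sum of L(H) and L(G),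
    this happens iff a = 0, which is omega-horizontality, and b = 0, which is
    the differential equation for h.

    With tangent vectors encoded as derivations the direct sum is seen by testing
    on functions pulled back along a projection: for f on G, b sees the function
    f o snd as the constant f 1 and thus annihilates it, so (a + b) (f o snd) =
    a f ([inclusions_independent]).  This requires a and b to annihilate
    constants.  As the forms take values in the Lie algebras only on genuine
    tangent vectors, one must know that d/dt and d/ds of the given map are
    derivations.  This is the analytic part ([velocity_tangent]): at every point
    of the closed interval the path has a smooth local extension, hence its
    difference quotients converge, and the algebra of limits yields linearity
    and the Leibniz rule.  The integrals cause no difficulty, because a pointwise
    integral of functionals which annihilate constants annihilates constants. *)

Set Implicit Arguments.
Unset Strict Implicit.

(** * Group laws and conjugation *)

Section LieGroupLaws.
Context {R : realType} (K : lieGroup R).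
Implicit Types x k : K.

Lemma lmulgV x : (x * x^-1)%lie = 1%lie.
Proof.
by apply: lmul_idem; rewrite -lmulA (lmulA (x^-1)%lie) lmulV lmul1.
Qed.

Lemma lmulg1 x : (x * 1)%lie = x.
Proof. by rewrite -(lmulV x) lmulA lmulgV lmul1. Qed.

Lemma lconjK k x : lconj (k^-1)%lie (lconj k x) = x.
Proof.
by rewrite /lconj !lmulA lmulV lmul1 -lmulA lmulgV lmulg1.
Qed.

Lemma smooth_lconj k : smooth (lconj k).
Proof.
apply: smooth_lmul; last exact: smooth_cst.
apply: smooth_lmul; [exact: smooth_cst|exact: smooth_id].
Qed.

End LieGroupLaws.

(** * The algebra of smooth functions *)

Section SmoothFunctions.
Context {R : realType} {M : manifold R}.
Implicit Types f g : M -> R.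

(** The line has a single global chart, so the transition conditions at the
    target disappear and only charts of the source remain. *)
Lemma smoothR_charts f : smoothR f <->
  continuous f /\ forall c, atlas c -> Cinfty (cfun c @` cdom c) (f \o cinv c).
Proof.
split=> -[cf sf]; split.
- by move=> x; exact: cf.
- move=> c ac; have := sf c line_chart ac erefl 0.
  rewrite setTI preimage_setT setIT /=.
  by under eq_fun do rewrite mxE.
- by move=> x _; exact: cf.
move=> c d ac -> j; rewrite setTI preimage_setT setIT /=.
by under eq_fun do rewrite mxE; exact: sf.
Qed.

Lemma smoothR_cst (r : R) : smoothR (cst r : M -> R).
Proof. exact: smooth_cst. Qed.

Lemma smoothRD f g : smoothR f -> smoothR g -> smoothR (f + g).
Proof.
move=> /smoothR_charts[cf sf] /smoothR_charts[cg sg]; apply/smoothR_charts.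
split=> [x|c ac k]; first by apply: continuousD; [exact: cf|exact: cg].
exact: (@Ck_add _ _ k _ (f \o cinv c) (g \o cinv c) (@cimg_open _ _ _ c) (sf c ac k) (sg c ac k)).
Qed.

Lemma smoothRM f g : smoothR f -> smoothR g -> smoothR (f * g).
Proof.
move=> /smoothR_charts[cf sf] /smoothR_charts[cg sg]; apply/smoothR_charts.
split=> [x|c ac k]; first by apply: continuousM; [exact: cf|exact: cg].
exact: (@Ck_mul _ _ k _ (f \o cinv c) (g \o cinv c) (@cimg_open _ _ _ c) (sf c ac k) (sg c ac k)).
Qed.

Lemma smoothRZ (a : R) f : smoothR f -> smoothR (a *: f).
Proof. by move=> sf; have -> : a *: f = cst a * f by []; exact: smoothRM (smoothR_cst a) sf. Qed.

End SmoothFunctions.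

(** * Velocities of paths on a closed interval *)

Section Velocity.
Context {R : realType}.

Definition dquot (f : R -> R) (t u : R) : R := (f u - f t) / (u - t).

(** A nondegenerate closed interval has no isolated point, not even an endpoint,
    so the one-sided limits defining velocities are unique. *)
Lemma within_itv_proper (a b t : R) : a < b -> a <= t <= b ->
  ProperFilter (within `[a, b] t^').
Proof.
move=> ab /andP[at_ tb]; apply: Build_ProperFilter_ex => A.
move=> /nbhs_ballP[e /= e0 eA].
have e20 : 0 < e / 2 by lra.
have e2e : e / 2 < e by lra.
(* A point of [a, b] within e of t is taken to the right of t, except when t = b. *)
case: (ltP t b) => [ltb|leb].
  have [u_b u_e] : Num.min b (t + e / 2) <= b /\ Num.min b (t + e / 2) <= t + e / 2.
    by rewrite !ge_min !lexx orbT.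
  have tu : t < Num.min b (t + e / 2) by rewrite lt_min ltb ltrDl.
  exists (Num.min b (t + e / 2)); apply: eA.
  - by rewrite /ball /= distrC gtr0_norm; lra.
  - by rewrite gt_eqF.
  - by rewrite in_itv /= u_b andbT; lra.
have [a_u e_u] : a <= Num.max a (t - e / 2) /\ t - e / 2 <= Num.max a (t - e / 2).
  by rewrite !le_max !lexx orbT.
have ut : Num.max a (t - e / 2) < t by rewrite gt_max; lra.
exists (Num.max a (t - e / 2)); apply: eA.
- by rewrite /ball /= gtr0_norm; lra.
- by rewrite lt_eqF.
- by rewrite in_itv /= a_u /=; lra.
Qed.

Lemma subr_cvg_dnbhs (t : R) : u - t @[u --> t^'] --> 0^'.
Proof.
move=> A /nbhs_ballP[e /= e0 eA]; apply/nbhs_ballP; exists e => //= u.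
rewrite /ball /= => ut; rewrite -subr_eq0 => u_t; apply: eA => //.
by rewrite /ball /= sub0r normrN -normrN opprB.
Qed.

(** Near t the path agrees on D with a smooth map g on an open set, and phi o g
    has an honest two-sided derivative; the difference quotients along D form a
    restriction of those of phi o g. *)
Lemma smooth_within_dquot_cvg {M : manifold R} (D : set R) (c : R -> M)
    (phi : M -> R) (t : R) :
  @smooth_within _ (line R) M D c -> smoothR phi -> D t ->
  cvg (dquot (phi \o c) t u @[u --> within D t^']).
Proof.
move=> sc sphi Dt; have [W [g [oW Wt sg gc]]] := sc t Dt.
have := smooth_on_comp oW openT sg sphi.
rewrite preimage_setT setIT => -[_ /(_ line_chart line_chart erefl erefl 0 1%N)].
rewrite preimage_setT !setIT /= => -[dF _].
have {}dF := dF (const_mx t) (ex_intro2 _ _ t Wt erefl).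
have /cvg_ex[l dl] := @diff_derivable _ _ _ _ _ (const_mx 1) dF.
apply/cvg_ex; exists l.
have {}dl : h^-1 * (phi (g (h + t)) - phi (g t)) @[h --> 0^'] --> (l : R).
  apply: cvg_trans dl; apply: near_eq_cvg; near=> u.
  by rewrite /= !mxE mulr1.
have sub_within : u - t @[u --> within D t^'] --> 0^'.
  by apply: cvg_trans (subr_cvg_dnbhs t); apply: cvg_app; exact: cvg_within.
have {}dl := cvg_comp _ _ sub_within dl.
apply: cvg_trans dl; apply: near_eq_cvg.
have nW : \forall u \near t, W u by exact: open_nbhs_nbhs.
rewrite near_withinE; near=> u => Du.
rewrite /dquot /= subrK -!gc //.
  by rewrite mulrC.
by near: u; apply: nbhs_dnbhs.
Unshelve. all: by end_near.
Qed.

Lemma velocityE {M : manifold R} (a b t : R) (c : R -> M) (phi : M -> R) :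
  smoothR phi ->
  velocity a b c t phi = lim (dquot (phi \o c) t u @[u --> within `[a, b] t^']).
Proof. by move=> sphi; rewrite /velocity asboolT. Qed.

Lemma dquot_lin (r : R) (f g : R -> R) t u :
  dquot (r *: f + g) t u = r * dquot f t u + dquot g t u.
Proof.
rewrite /dquot; change ((r *: f + g) u) with (r * f u + g u).
change ((r *: f + g) t) with (r * f t + g t).
by rewrite mulrA -mulrDl; congr (_ / _); ring.
Qed.

(** The error term is kept as (u - t) times a product of difference quotients, so
    that passing to the limit uses only the convergence of the quotients and not
    the continuity of f or g. *)
Lemma dquotM (f g : R -> R) t u : dquot (f * g) t u =
  dquot f t u * g t + f t * dquot g t u + (u - t) * (dquot f t u * dquot g t u).
Proof.
rewrite /dquot; change ((f * g) u) with (f u * g u).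
change ((f * g) t) with (f t * g t).
(* At u = t all quotients are 0 / 0 = 0. *)
have [->|ut] := eqVneq u t; first by rewrite !subrr !mul0r !mulr0 !addr0.
have := ut; rewrite -subr_eq0 => ut0.
by field.
Qed.

(** The hypothesis a < b excludes a one-point interval, where the limit is along
    the trivial filter. *)
Lemma velocity_tangent {M : manifold R} (a b t : R) (c : R -> M) :
  a < b -> a <= t <= b -> @smooth_within _ (line R) M `[a, b] c ->
  tangent (c t) (velocity a b c t).
Proof.
move=> ab tab sc; have pF := within_itv_proper ab tab.
have Dt : `[a, b]%classic t by rewrite /= in_itv.
have cvgq phi : smoothR phi ->
    dquot (phi \o c) t u @[u --> within `[a, b] t^'] --> velocity a b c t phi.
  by move=> sphi; rewrite velocityE//; exact: smooth_within_dquot_cvg sphi Dt.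
split=> [r f g sf sg|f g sf sg|f nsf]; last by rewrite /velocity asboolF.
  rewrite [LHS]velocityE; last exact: smoothRD (smoothRZ _ sf) sg.
  apply: cvg_lim => //.
  have -> : dquot ((r *: f + g) \o c) t =
      (fun u => r * dquot (f \o c) t u + dquot (g \o c) t u).
    by apply/funext => u; exact: dquot_lin.
  by apply: cvgD (cvgq g sg); apply: cvgM (cvgq f sf); exact: cvg_cst.
rewrite [LHS]velocityE; last exact: smoothRM.
apply: cvg_lim => //.
have -> : dquot ((f * g) \o c) t = (fun u =>
    dquot (f \o c) t u * g (c t) + f (c t) * dquot (g \o c) t u
    + (u - t) * (dquot (f \o c) t u * dquot (g \o c) t u)).
  by apply/funext => u; exact: (dquotM (f \o c) (g \o c)).
have u_t : u - t @[u --> within `[a, b] t^'] --> (0 : R).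
  apply: cvg_trans (cvg_trans (subr_cvg_dnbhs t) (@nbhs_dnbhs _ 0)).
  by apply: cvg_app; exact: cvg_within.
rewrite -[X in _ --> X]addr0 -[X in _ --> _ + X](mul0r (velocity a b c t f * velocity a b c t g)).
apply: cvgD; last by apply: cvgM u_t _; exact: cvgM (cvgq f sf) (cvgq g sg).
apply: cvgD; first by apply: cvgM (cvgq f sf) _; exact: cvg_cst.
by apply: cvgM (cvgq g sg); exact: cvg_cst.
Qed.

End Velocity.

(** * Functionals annihilating constants *)

Section Functionals.
Context {R : realType}.

(** A consequence of tangency that makes no reference to a base point and is
    stable under sums and, with no regularity of the integrand, under integrals;
    linearity would not pass to integrals so cheaply.  The second clause is the
    convention that makes two functionals equal as soon as they agree on the
    smooth functions. *)
Definition kills_constants {M : manifold R} (v : vec M) :=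
  (forall r : R, v (cst r) = 0) /\ (forall f, ~ smoothR f -> v f = 0).

Context {M N : manifold R}.
Implicit Types v w : vec M.

Lemma tangent_kills_constants (p : M) v : tangent p v -> kills_constants v.
Proof.
move=> [lin leib nsm]; split=> [r|//].
have v1 : v (cst 1) = 0.
  have := leib _ _ (smoothR_cst (1 : R)) (smoothR_cst (1 : R)).
  have -> : cst 1 * cst 1 = cst 1 :> (M -> R) by apply/funext => x; exact: mulr1.
  rewrite /= mulr1 mul1r; lra.
have v0 : v (cst 0) = 0.
  have := leib _ _ (smoothR_cst (0 : R)) (smoothR_cst (0 : R)).
  have -> : cst 0 * cst 0 = cst 0 :> (M -> R) by apply/funext => x; exact: mulr0.
  by rewrite /= mulr0 mul0r addr0.
have := lin r _ _ (smoothR_cst (1 : R)) (smoothR_cst (0 : R)).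
have -> : r *: cst 1 + cst 0 = cst r :> (M -> R).
  by apply/funext => x; rewrite -[RHS]mulr1 -[RHS]addr0.
by move=> ->; rewrite v1 v0 mulr0 addr0.
Qed.

Lemma kills_constantsD v w : kills_constants v -> kills_constants w ->
  kills_constants (v + w).
Proof.
move=> [vc vn] [wc wn]; split=> [r|f nf].
  by change (v (cst r) + w (cst r) = 0); rewrite vc wc addr0.
by change (v f + w f = 0); rewrite vn // wn // addr0.
Qed.

Lemma kills_constantsB v w : kills_constants v -> kills_constants w ->
  kills_constants (v - w).
Proof.
move=> [vc vn] [wc wn]; split=> [r|f nf].
  by change (v (cst r) - w (cst r) = 0); rewrite vc wc subr0.
by change (v f - w f = 0); rewrite vn // wn // subr0.
Qed.

Lemma kills_constants_vint (a b : R) (F : R -> vec M) :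
  (forall t, a <= t <= b -> kills_constants (F t)) -> kills_constants (vint a b F).
Proof.
move=> rF; split=> [r|f nf]; rewrite /vint /Rintegral integral0_eq// => t /=;
  rewrite in_itv => /rF[cF nF].
- by rewrite cF.
- by rewrite nF.
Qed.

Lemma kills_constants_push (f : M -> N) v : kills_constants v -> kills_constants (push f v).
Proof.
move=> [vc _]; split=> [r|phi nphi]; rewrite /push; last by rewrite asboolF.
by case: ifP => // _; exact: vc.
Qed.

End Functionals.

(** * The adjoint action and the splitting of L(H x| G) *)

Section AdjointAction.
Context {R : realType} (K : lieGroup R).

(** Conjugation by k has the smooth inverse conjugation by k^-1, so Ad k v tested
    on phi o lconj k^-1 recovers v phi. *)
Lemma Ad_inj0 (k : K) (v : vec K) :
  (forall f, ~ smoothR f -> v f = 0) -> Ad k v = 0 -> v = 0.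
Proof.
move=> vn Adv0; apply/funext => phi.
have [sphi|nphi] := pselect (smoothR phi); last exact: vn.
pose psi : K -> R := phi \o lconj (k^-1)%lie.
have spsi : smoothR psi by exact: smooth_comp (smooth_lconj (k^-1)%lie) sphi.
have := congr1 (fun w : vec K => w psi) Adv0.
rewrite /Ad /push asboolT //.
have -> // : psi \o lconj k = phi.
by apply/funext => x; rewrite /psi /= lconjK.
Qed.

End AdjointAction.

Section Push.
Context {R : realType} {M N : manifold R} (f : M -> N).

Lemma push0 : push f 0 = 0.
Proof. by apply/funext => phi; rewrite /push; case: ifP. Qed.

End Push.

Section Inclusions.
Context {R : realType} (G H : lieGroup R) (X : crossedModule G H).

(** A function pulled back along one projection of H x G is constant on the other
    factor, hence seen by only one of a and b. *)
Lemma inclusions_independent (a : vec G) (b : vec H) :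
  kills_constants a -> kills_constants b ->
  inclG (X := X) a + inclH (X := X) b = 0 -> a = 0 /\ b = 0.
Proof.
move=> [ac an] [bc bn] ab0.
have ab phi : @smoothR _ (semidirect X) phi ->
    a (fun g => phi (1%lie, g)) + b (fun h => phi (h, 1%lie)) = 0.
  move=> sphi; have := congr1 (fun w : vec (semidirect X) => w phi) ab0.
  by rewrite -[_ phi in LHS]/(inclG (X := X) a phi + inclH (X := X) b phi)
    /inclG /inclH /push asboolT.
split; apply/funext => psi.
  have [spsi|] := pselect (smoothR psi); last exact: an.
  have /ab := smooth_comp (smooth_snd H G) spsi.
  by rewrite (bc (psi 1%lie) : b (fun h : H => (psi \o snd) (h, 1%lie)) = 0) addr0.
have [spsi|] := pselect (smoothR psi); last exact: bn.
have /ab := smooth_comp (smooth_fst H G) spsi.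
by rewrite (ac (psi 1%lie) : a (fun g : G => (psi \o fst) (1%lie, g)) = 0) add0r.
Qed.

Lemma Ad_incl_eq0 (k : semidirect X) (a : vec G) (b : vec H) :
  kills_constants a -> kills_constants b ->
  Ad k (inclG (X := X) a + inclH (X := X) b) = 0 <-> a = 0 /\ b = 0.
Proof.
move=> ra rb; split=> [Ad0|[-> ->]].
  apply: (inclusions_independent ra rb); apply: Ad_inj0 Ad0 => f nf.
  by rewrite -[LHS]/(inclG (X := X) a f + inclH (X := X) b f)
    /inclG /inclH /push asboolF // addr0.
by rewrite /inclG /inclH !push0 addr0 /Ad push0.
Qed.

End Inclusions.

(** * Horizontal paths on the decorated bundle *)

Section Slices.
Context {R : realType} {M : manifold R}.

Lemma smooth_within_slice2 (D D' : set R) (F : R * R -> M) (t : R) :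
  @smooth_within _ (prodM (line R) (line R)) M (D `*` D') F -> D t ->
  @smooth_within _ (line R) M D' (fun s => F (t, s)).
Proof.
move=> sF Dt s Ds; have [//|W [g [oW Wts sg gF]]] := sF (t, s).
pose i : line R -> prodM (line R) (line R) := fun s' => (t, s').
have si : smooth i := smooth_pair (smooth_cst (line R) (t : line R)) (smooth_id (line R)).
exists (setT `&` i @^-1` W), (g \o i); split => //.
- apply: open_preimage => //; [exact: openT|exact: si.1].
- exact: smooth_on_comp openT oW si sg.
by move=> y Dy [_ Wy]; exact: gF.
Qed.

End Slices.

Unset Implicit Arguments.
Set Strict Implicit.

Theorem proposition6p1 (R : realType) (G H : lieGroup R)
    (X : crossedModule G H) (P M : manifold R) (E : principalBundle G P M)
    (Abar A : form1 P G) (B0 : form2 P G) (B1 : form2 P H)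
    (C0L C0R : form1 P G) (C1L C1R : form1 P H)
    (t0 t1 s0 s1 : R) (Gam : R * R -> P) (h : R -> H) :
  connection_form E Abar -> connection_form E A ->
  eqhor_form2 E (@Ad R G) B0 ->
  eqhor_form2 E (fun g => push (alpha X g)) B1 ->
  eqhor_form1 E (@Ad R G) C0L -> eqhor_form1 E (@Ad R G) C0R ->
  eqhor_form1 E (fun g => push (alpha X g)) C1L ->
  eqhor_form1 E (fun g => push (alpha X g)) C1R ->
  t0 < t1 -> s0 < s1 ->
  decorated_path E Abar t0 t1 s0 s1 Gam h ->
  Omega_horizontal X A C0L C0R B0 C1L C1R B1 t0 t1 s0 s1 Gam h <->
  omega_horizontal A C0L C0R B0 t0 t1 s0 s1 Gam /\
  (forall s, s0 <= s <= s1 ->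
     rtransl (h s) (velocity s0 s1 h s) =
     - (C1R (Gam (t1, s)) (ds s0 s1 Gam s t1)
        - C1L (Gam (t0, s)) (ds s0 s1 Gam s t0)
        + vint t0 t1 (fun t => B1 (Gam (t, s)) (ds s0 s1 Gam s t)
                                 (velocity t0 t1 (fun t' => Gam (t', s)) t)))).
Proof.
move=> _ [[fA _ _] _ _] [[fB0 _ _ _] _ _] [[fB1 _ _ _] _ _] [[fC0L _ _] _ _]
  [[fC0R _ _] _ _] [[fC1L _ _] _ _] [[fC1R _ _] _ _] t01 s01 [Gsm Ghor hsm _].
have t0in : t0 <= t0 <= t1 by rewrite lexx ltW.
have t1in : t0 <= t1 <= t1 by rewrite lexx ltW.
have dsT s t : s0 <= s <= s1 -> t0 <= t <= t1 ->
    tangent (Gam (t, s)) (ds s0 s1 Gam s t).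
  move=> ss tt; apply: (velocity_tangent (c := fun s' => Gam (t, s'))) => //.
  by apply: smooth_within_slice2 Gsm _; rewrite /= in_itv.
have dtT s t : s0 <= s <= s1 -> t0 <= t <= t1 ->
    tangent (Gam (t, s)) (velocity t0 t1 (fun t' => Gam (t', s)) t).
  move=> ss tt; apply: (velocity_tangent (c := fun t' => Gam (t', s))) => //.
  by have [] := Ghor s ss.
have omega_kills s : s0 <= s <= s1 -> kills_constants
    (omega A C0L C0R B0 t0 t1 (fun t => Gam (t, s)) (ds s0 s1 Gam s)).
  move=> ss; rewrite /omega; apply: kills_constantsD.
    apply: kills_constantsB; first apply: kills_constantsD.
    - by apply: tangent_kills_constants (fA _ _ _); exact: dsT.
    - by apply: tangent_kills_constants (fC0R _ _ _); exact: dsT.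
    - by apply: tangent_kills_constants (fC0L _ _ _); exact: dsT.
  apply: kills_constants_vint => t tt.
  by apply: tangent_kills_constants (fB0 _ _ _ _ _); [exact: dsT|exact: dtT].
have bracket_kills s : s0 <= s <= s1 -> kills_constants
    (C1R (Gam (t1, s)) (ds s0 s1 Gam s t1) - C1L (Gam (t0, s)) (ds s0 s1 Gam s t0)
     + vint t0 t1 (fun t => B1 (Gam (t, s)) (ds s0 s1 Gam s t)
                              (velocity t0 t1 (fun t' => Gam (t', s)) t))
     + rtransl (h s) (velocity s0 s1 h s)).
  move=> ss; apply: kills_constantsD; first apply: kills_constantsD.
  - apply: kills_constantsB.
    + by apply: tangent_kills_constants (fC1R _ _ _); exact: dsT.
    + by apply: tangent_kills_constants (fC1L _ _ _); exact: dsT.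
  - apply: kills_constants_vint => t tt.
    by apply: tangent_kills_constants (fB1 _ _ _ _ _); [exact: dsT|exact: dtT].
  - apply: kills_constants_push; apply: tangent_kills_constants (velocity_tangent s01 ss hsm).
have Omega0 s : s0 <= s <= s1 ->
    Omega (X := X) A C0L C0R B0 C1L C1R B1 t0 t1 (fun t => Gam (t, s)) (h s)
      (ds s0 s1 Gam s) (velocity s0 s1 h s) = 0 <->
    omega A C0L C0R B0 t0 t1 (fun t => Gam (t, s)) (ds s0 s1 Gam s) = 0 /\
    C1R (Gam (t1, s)) (ds s0 s1 Gam s t1) - C1L (Gam (t0, s)) (ds s0 s1 Gam s t0)
     + vint t0 t1 (fun t => B1 (Gam (t, s)) (ds s0 s1 Gam s t)
                              (velocity t0 t1 (fun t' => Gam (t', s)) t))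
     + rtransl (h s) (velocity s0 s1 h s) = 0.
  by move=> ss; exact: Ad_incl_eq0 (omega_kills s ss) (bracket_kills s ss).
split=> [hor|[hor eqh] s ss].
  split=> s ss; have [om eqh] := (Omega0 s ss).1 (hor s ss); first exact: om.
  by apply/eqP; rewrite -addr_eq0 addrC eqh.
by apply/(Omega0 s ss); split; [exact: hor|rewrite eqh // subrr].
Qed.
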